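(* Let $r_0\approx 0.546302$ be the positive root of $r^2+2\cot(1)\,r-1=0$, and let $\alpha_1,\alpha_2>0$ satisfy $\alpha_1-\alpha_2\ge e\,r_0$. Let $p$ be analytic in $\mathbb{D}$ with $p(0)=1$. If $$1+\alpha_1 zp'(z)+\alpha_2 z^2p''(z)\prec \frac{2}{1+e^{-z}},$$ then $p(z)\prec e^z$.
   Context: $\mathbb{D}$ is the open unit disk. For $g,h$ analytic in $\mathbb{D}$, $g\prec h$ means there is an analytic $w:\mathbb{D}\to\mathbb{D}$ with $w(0)=0$ and $g=h\circ w$. *)

(* Defs.v *)
From Stdlib Require Import Reals.
From Coquelicot Require Import Coquelicot.
Open Scope R_scope.

Definition Cexp (z : C) : C :=
  (exp (fst z) * cos (snd z), exp (fst z) * sin (snd z)).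

Definition inD (z : C) : Prop := Cmod z < 1.

Definition Cderiv (f : C -> C) (z l : C) : Prop :=
  @is_derive C_AbsRing C_NormedModule f z l.

Definition analytic_on_D (f : C -> C) : Prop :=
  forall z, inD z -> exists l, Cderiv f z l.

Definition subordinate (g h : C -> C) : Prop :=
  exists w : C -> C, analytic_on_D w /\ (forall z, inD z -> inD (w z)) /\
    w (RtoC 0) = RtoC 0 /\ (forall z, inD z -> g z = h (w z)).

(* Main.v *)
Require Import Defs.
From Stdlib Require Import Reals Lra Psatz.
From Coquelicot Require Import Coquelicot.

(** The modified sigmoid minus 1 is tanh (w / 2), of modulus at most 1/sqrt 3 on the disk.
    With c = a1 - a2, the hypothesis reads c q + a2 z q' = phi for q = z p', with |phi| <= 0.578;
    looking at the maximum of Re (k q) along a ray gives |q| <= 0.578 / c. Since |q| bounds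
    the angular derivative of p, and the mean of p over a circle is p 0 = 1, it follows that
    |p - 1| <= (pi / 2) (0.578 / c), which is below 1 - 1/e because r0 = tan (1 / 2) > 0.5425.
    Finally |log (1 + u)| <= - ln (1 - |u|), so that log p is the required Schwarz function. *)


(** * Complex derivatives and their real traces along curves *)

Lemma Cderiv_iff (f : C -> C) (z l : C) :
  Cderiv f z l <->
  forall eps : R, 0 < eps -> exists delta : R, 0 < delta /\
    forall y, Cmod (y - z) < delta ->
      Cmod (f y - f z - (y - z) * l) <= eps * Cmod (y - z).
Proof.
split.
- intros [_ H] eps Heps.
  destruct (H z (fun P HP => HP) (mkposreal eps Heps)) as [d Hd].
  exists d; split; [apply cond_pos|].
  intros y Hy; exact (Hd y Hy).
- intros H; split; [apply is_linear_scal_l|].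
  intros x Hx eps.
  replace x with z by
    exact (is_filter_lim_locally_unique (V:=AbsRing_NormedModule C_AbsRing) z x Hx).
  destruct (H eps (cond_pos eps)) as [d [Hd Hy]].
  exists (mkposreal d Hd); exact Hy.
Qed.

(** The derivative uses the topology of the modulus, the continuity the product topology;
    [locally_C] identifies the two. *)
Lemma Cderiv_continuous (f : C -> C) (z l : C) :
  Cderiv f z l -> continuous (T:=C_UniformSpace) (U:=C_UniformSpace) f z.
Proof.
intros H P HP.
assert (K := ex_derive_continuous (K:=C_AbsRing) (V:=C_NormedModule) f z
  (ex_intro _ l H) P HP).
apply locally_C; exact K.
Qed.

Lemma norm_C_R (x : C) : norm (V:=C_R_NormedModule) x = Cmod x.
Proof.
unfold norm, Cmod; simpl; unfold prod_norm, norm; simpl; unfold abs; simpl.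
f_equal; f_equal; rewrite ?Rmult_1_r, <- Rabs_mult; apply Rabs_pos_eq, Rle_0_sqr.
Qed.

Lemma filterdiff_Re_mult (c : C) (f : C -> C) (z l : C) :
  Cderiv f z l ->
  filterdiff (K:=R_AbsRing) (U:=C_R_NormedModule) (V:=R_NormedModule)
    (fun t => Re (c * f t)%C) (locally z) (fun h => Re (c * (h * l))%C).
Proof.
intros H; split.
- split.
  + intros [x1 x2] [y1 y2]; destruct c, l; unfold plus; simpl; unfold Re, plus; simpl; ring.
  + intros k [x1 x2]; destruct c, l; unfold scal, Re; simpl; unfold scal, mult; simpl;
    unfold mult; simpl; ring.
  + exists (Cmod c * Cmod l + 1); split.
    * generalize (Rmult_le_pos _ _ (Cmod_ge_0 c) (Cmod_ge_0 l)); lra.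
    * intros x.
      rewrite norm_C_R.
      change (Rabs (Re (c * (x * l))%C) <= (Cmod c * Cmod l + 1) * Cmod x).
      eapply Rle_trans; [apply re_le_Cmod|]; rewrite !Cmod_mult.
      generalize (Cmod_ge_0 x); nra.
- intros x Hx eps.
  replace x with z by exact (is_filter_lim_locally_unique (V:=C_R_NormedModule) z x Hx).
  pose proof (Cmod_ge_0 c) as Hc.
  destruct (proj1 (Cderiv_iff f z l) H (eps / (Cmod c + 1))) as [d [Hd Hy]].
  { apply Rdiv_lt_0_compat; [apply cond_pos | lra]. }
  apply locally_C; exists (mkposreal d Hd); intros y Yy.
  specialize (Hy y Yy).
  rewrite norm_C_R.
  change (Rabs (Re (c * f y)%C - Re (c * f z)%C - Re (c * ((y - z) * l))%C)
    <= eps * Cmod (y - z)).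
  replace (Re (c * f y)%C - Re (c * f z)%C - Re (c * ((y - z) * l))%C) with
    (Re (c * (f y - f z - (y - z) * l))%C)
    by (unfold Re, Cmult, Cminus, Cplus, Copp; simpl; ring).
  eapply Rle_trans; [apply re_le_Cmod|]; rewrite Cmod_mult.
  eapply Rle_trans; [apply Rmult_le_compat_l, Hy; exact Hc|].
  pose proof (Cmod_ge_0 (y - z)) as Hyz.
  pose proof (cond_pos eps) as He.
  replace (Cmod c * (eps / (Cmod c + 1) * Cmod (y - z))) with
    (eps * Cmod (y - z) * (Cmod c / (Cmod c + 1))) by (field; lra).
  rewrite <- (Rmult_1_r (eps * Cmod (y - z))) at 2.
  apply Rmult_le_compat_l; [nra|].
  apply Rle_div_l; lra.
Qed.

(** Testing against a constant [c] makes [f] real-valued, so that real mean value theorems and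
    integrals apply; [Cmod_le_of_Re] later recovers the modulus. *)
Lemma is_derive_Re_curve (c : C) (f : C -> C) (l : C) (g1 g2 : R -> R) (s d1 d2 : R) :
  Cderiv f (g1 s, g2 s) l -> is_derive g1 s d1 -> is_derive g2 s d2 ->
  is_derive (fun x => Re (c * f (g1 x, g2 x))%C) s (Re (c * ((d1, d2) * l))%C).
Proof.
intros H H1 H2.
pose proof (filterdiff_comp'_2 (K:=R_AbsRing) (T:=R_NormedModule) (U:=R_NormedModule)
  (V:=R_NormedModule) (W:=R_NormedModule) g1 g2
  (fun a b => Re (c * f (a, b))%C) s _ _ (fun a b => Re (c * ((a, b) * l))%C) H1 H2) as K.
eapply filterdiff_ext_lin.
- apply K.
  eapply filterdiff_ext_lin.
  + eapply filterdiff_ext; [|exact (filterdiff_Re_mult c f (g1 s, g2 s) l H)].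
    intros [a b]; reflexivity.
  + intros [a b]; reflexivity.
- intros y; destruct c, l; unfold Re, scal; simpl; unfold mult; simpl; ring.
Qed.

(** For [u] nonzero, the unimodular factor [Cconj u / Cmod u] rotates [u] onto [Cmod u]. *)
Lemma Cmod_le_of_Re (B : R) (u : C) : 0 <= B ->
  (forall c, Cmod c = 1 -> Re (c * u)%C <= B) -> Cmod u <= B.
Proof.
intros HB H.
destruct (Ceq_dec u (RtoC 0)) as [->|Hu]; [now rewrite Cmod_0|].
apply Cmod_gt_0 in Hu.
specialize (H (Cconj u / Cmod u)%C).
replace (Re (Cconj u / Cmod u * u)%C) with (Cmod u) in H.
- apply H.
  rewrite Cmod_div by (intros E; apply (f_equal Re) in E; simpl in E; lra).
  rewrite Cmod_conj, Cmod_R, Rabs_pos_eq by lra.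
  field; lra.
- pose proof (Cmod2_alt u) as E.
  apply Rmult_eq_reg_r with (Cmod u); [|lra].
  transitivity (Cmod u ^ 2); [ring|]; rewrite E.
  destruct u as [a b]; unfold Re, Im, Cconj, Cdiv, Cinv, Cmult; simpl; field.
  simpl in Hu; lra.
Qed.

(** * The bound on the sigmoid and the numerical constants *)

(** On [0, 1] the second derivative [exp t + exp (- t)] is at most 3 + 1 = 4; two uses of the mean
    value theorem give the bound there, and evenness the rest. *)
Lemma exp_sym_le_quadratic (x : R) : Rabs x <= 1 -> exp x + exp (- x) <= 2 + 2 * x ^ 2.
Proof.
intros Hx.
assert (H : forall y, 0 <= y <= 1 -> exp y + exp (- y) <= 2 + 2 * y ^ 2).
{ intros y Hy.
  assert (D : forall t, 0 <= t <= 1 -> exp t - exp (- t) <= 4 * t).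
  { intros t Ht.
    destruct (MVT_gen (fun u => exp u - exp (- u)) 0 t (fun u => exp u + exp (- u)))
      as [c [Hc E]].
    - intros u _; auto_derive; [easy | ring].
    - intros u _; apply derivable_continuous_pt, ex_derive_Reals_0; auto_derive; easy.
    - rewrite Rmin_left, Rmax_right in Hc by lra.
      rewrite Ropp_0, Rminus_diag, !Rminus_0_r in E; rewrite E.
      assert (exp c <= 3).
      { apply Rle_trans with (exp 1); [|exact exp_le_3].
        destruct (Req_dec c 1) as [->|]; [lra|]. left; apply exp_increasing; lra. }
      assert (exp (- c) <= 1).
      { rewrite <- exp_0.
        destruct (Req_dec c 0) as [->|]; [rewrite Ropp_0; lra|].
        left; apply exp_increasing; lra. }
      nra. }
  destruct (MVT_gen (fun u => 2 * u ^ 2 - exp u - exp (- u)) 0 y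
    (fun u => 4 * u - (exp u - exp (- u)))) as [c [Hc E]].
  - intros u _; auto_derive; [easy | ring].
  - intros u _; apply derivable_continuous_pt, ex_derive_Reals_0; auto_derive; easy.
  - rewrite Rmin_left, Rmax_right in Hc by lra.
    rewrite Ropp_0, exp_0 in E.
    specialize (D c ltac:(lra)); nra. }
destruct (Rle_dec 0 x) as [Hp|Hn].
- apply H; rewrite Rabs_pos_eq in Hx; lra.
- specialize (H (- x)); rewrite Ropp_involutive in H.
  rewrite Rabs_left in Hx by lra.
  specialize (H ltac:(lra)); lra.
Qed.

(** This is [1 - cos y = 2 sin^2 (y / 2)] together with [|sin t| <= |t|]. *)
Lemma cos_ge_quadratic (y : R) : 1 - y ^ 2 / 2 <= cos y.
Proof.
assert (H : forall t, sin t ^ 2 <= t ^ 2).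
{ assert (P : forall t, 0 <= t -> sin t ^ 2 <= t ^ 2).
  { intros t [Ht | <-]; [|rewrite sin_0; lra].
    pose proof (sin_lt_x t Ht); pose proof (SIN_bound t).
    destruct (Rle_dec 1 t); [nra|].
    pose proof PI2_1; pose proof (sin_ge_0 t ltac:(lra) ltac:(lra)); nra. }
  intros t; destruct (Rle_dec 0 t); [now apply P|].
  specialize (P (- t) ltac:(lra)); rewrite sin_neg in P; nra. }
replace y with (2 * (y / 2)) at 2 by field.
rewrite cos_2a_sin; specialize (H (y / 2)); nra.
Qed.

Lemma sigmoid_bound (w : C) : inD w ->
  Cmod (RtoC 2 / (RtoC 1 + Cexp (- w)) - RtoC 1) <= 0.578.
Proof.
destruct w as [x y]; unfold inD; intros Hw.
assert (Hxy : x ^ 2 + y ^ 2 < 1).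
{ pose proof (Cmod2_alt (x, y)) as E; unfold Re, Im in E; simpl fst in E; simpl snd in E.
  pose proof (Cmod_ge_0 (x, y)); nra. }
assert (Hx : Rabs x <= 1) by (apply Rabs_le; nra).
pose proof (exp_sym_le_quadratic x Hx) as Hch.
pose proof (cos_ge_quadratic y) as Hcos.
pose proof (exp_pos x) as Hex; pose proof (exp_pos (- x)) as Hemx.
assert (He : exp x * exp (- x) = 1) by (rewrite <- exp_plus, Rplus_opp_r; apply exp_0).
pose proof (sin2_cos2 y) as Hsc; unfold Rsqr in Hsc.
set (e := exp (- x)) in *; set (c := cos y) in *; set (s := sin y) in *.
(* [4 cos y >= 2 + 2 x^2 >= e^x + e^-x], whence the squared modulus is at most 1/3 < 0.578^2. *)
assert (K : 1 + e ^ 2 <= 4 * e * c).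
{ replace (1 + e ^ 2) with (e * (exp x + e)) by nra.
  assert (exp x + e <= 4 * c) by nra; nra. }
assert (Hc : 0 < c) by nra.
replace (Cexp (- (x, y))) with ((e * c)%R, (- (e * s))%R)
  by (unfold Cexp; simpl; rewrite cos_neg, sin_neg; fold e c s; f_equal; ring).
assert (Hd : (RtoC 1 + ((e * c)%R, (- (e * s))%R))%C <> RtoC 0).
{ intros E; apply (f_equal fst) in E; simpl in E; nra. }
replace (RtoC 2 / (RtoC 1 + ((e * c)%R, (- (e * s))%R)) - RtoC 1)%C
  with ((RtoC 1 - ((e * c)%R, (- (e * s))%R)) / (RtoC 1 + ((e * c)%R, (- (e * s))%R)))%C
  by (field; exact Hd).
rewrite Cmod_div by exact Hd.
apply Cmod_gt_0 in Hd as Hd'.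
apply Rle_div_l; [exact Hd'|].
apply Rsqr_incr_0_var; [|nra].
unfold Rsqr.
pose proof (Cmod2_alt (RtoC 1 + ((e * c)%R, (- (e * s))%R))) as E1.
pose proof (Cmod2_alt (RtoC 1 - ((e * c)%R, (- (e * s))%R))) as E2.
simpl in E1, E2.
set (m1 := Cmod (RtoC 1 + ((e * c)%R, (- (e * s))%R))) in *.
set (m2 := Cmod (RtoC 1 - ((e * c)%R, (- (e * s))%R))) in *.
(* With these two formulas, [K] says exactly that [3 * m2 ^ 2 <= m1 ^ 2], and 0.578^2 exceeds
   1/3. *)
assert (F1 : m1 ^ 2 = 1 + 2 * e * c + e ^ 2).
{ replace (e ^ 2) with (e * e * (s * s + c * c)) by (rewrite Hsc; ring).
  simpl; rewrite E1; ring. }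
assert (F2 : m2 ^ 2 = 1 - 2 * e * c + e ^ 2).
{ replace (e ^ 2) with (e * e * (s * s + c * c)) by (rewrite Hsc; ring).
  simpl; rewrite E2; ring. }
nra.
Qed.

(** The Taylor polynomial [1 - x^2/2 + x^4/24] bounds the cosine from above and is negative at 1.6,
    so 1.6 lies beyond [PI / 2]. *)
Lemma PI_lt_3_2 : PI < 3.2.
Proof.
destruct (Rlt_dec PI 3.2) as [|H]; [assumption|exfalso].
pose proof (cos_ge_0 1.6 ltac:(pose proof PI_RGT_0; lra) ltac:(lra)).
pose proof (pre_cos_bound 1.6 0 ltac:(lra) ltac:(lra)) as [_ B].
unfold cos_approx, cos_term in B; simpl in B; lra.
Qed.

(** The margin is narrow: 1.6 * 0.578 = 0.9248, against 1.7083 * 0.5425 > 0.9267. The Taylor bounds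
    cos 1 <= 13/24 and sin 1 >= 5/6 give cot 1 <= 0.65, and the positive root of r^2 + 1.3 r - 1
    exceeds 0.5425. *)
Lemma constant_estimate (r0 : R) : 0 < r0 ->
  r0 ^ 2 + 2 * (cos 1 / sin 1) * r0 - 1 = 0 ->
  PI / 2 * 0.578 < (exp 1 - 1) * r0.
Proof.
intros Hr H.
pose proof (pre_cos_bound 1 0 ltac:(lra) ltac:(lra)) as [_ B].
pose proof (pre_sin_bound 1 0 ltac:(lra) ltac:(lra)) as [B' _].
unfold cos_approx, cos_term in B; unfold sin_approx, sin_term in B'; simpl in B, B'.
assert (Hcot : cos 1 / sin 1 <= 0.65) by (apply Rle_div_l; lra).
assert (0.5425 < r0) by nra.
pose proof (exp_ge_taylor 1 4 ltac:(lra)) as E; simpl in E.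
pose proof PI_lt_3_2.
assert (1.7083 <= exp 1 - 1) by lra.
nra.
Qed.

(** * A maximum argument along rays *)

(** Only points on the left are compared, because the maximum along a ray may sit at the endpoint
    1. *)
Lemma is_derive_ge_0_of_left_max (f : R -> R) (a x l : R) : a < x ->
  is_derive f x l -> (forall y, a <= y <= x -> f y <= f x) -> 0 <= l.
Proof.
intros Hax Hd Hmax.
destruct (Rle_dec 0 l) as [|Hl]; [assumption|exfalso].
apply is_derive_Reals in Hd.
destruct (Hd (- l) ltac:(lra)) as [[d Hd0] H]; simpl in H.
set (h := Rmin (d / 2) (x - a)).
assert (Hh : 0 < h) by (apply Rmin_glb_lt; lra).
assert (h <= d / 2) by apply Rmin_l.
assert (h <= x - a) by apply Rmin_r.
specialize (H (- h) ltac:(lra) ltac:(rewrite Rabs_Ropp, Rabs_pos_eq; lra)).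
specialize (Hmax (x + - h) ltac:(lra)).
apply Rabs_lt_between in H.
assert ((f (x + - h) - f x) / - h < 0) as K by lra.
assert (0 <= (f x - f (x + - h)) / h) by (apply Rdiv_le_0_compat; lra).
replace ((f (x + - h) - f x) / - h) with ((f x - f (x + - h)) / h) in K by (field; lra).
lra.
Qed.

Lemma Cmod_scale (s x y : R) : Cmod (s * x, s * y) = Rabs s * Cmod (x, y).
Proof.
rewrite <- Cmod_R, <- Cmod_mult; f_equal.
unfold Cmult; simpl; f_equal; ring.
Qed.

(* Along a ray [a2 s q' + c q] is bounded by [K]; at a maximum of [q] over [0,1] the
   derivative is nonnegative. *)
Lemma radial_bound (c a2 K : R) (p1 p2 : C -> C) : 0 < c -> 0 < a2 -> 0 <= K ->
  (forall z, inD z -> Cderiv p1 z (p2 z)) ->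
  (forall z, inD z -> Cmod (RtoC (c + a2) * z * p1 z + RtoC a2 * (z * z) * p2 z) <= K) ->
  forall z, inD z -> Cmod (z * p1 z) <= K / c.
Proof.
intros Hc Ha2 HK Hd Hb [x y] Hz.
assert (HKc : 0 <= K / c) by (apply Rdiv_le_0_compat; lra).
apply Cmod_le_of_Re; [exact HKc|].
intros k Hk.
(* With [q z = z * p1 z], the function to be maximised is [s * g s], the real part of [k * q] at
   [s * (x, y)]. *)
set (g := fun s => Re (k * (x, y) * p1 (s * x, s * y)%R)%C).
set (dg := fun s => Re (k * (x, y) * ((x, y) * p2 (s * x, s * y)%R))%C).
assert (HD : forall s, 0 <= s <= 1 -> inD (s * x, s * y)%R).
{ intros s Hs; unfold inD in *; rewrite Cmod_scale, Rabs_pos_eq by lra.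
  pose proof (Cmod_ge_0 (x, y)); nra. }
assert (Dg : forall s, 0 <= s <= 1 -> is_derive g s (dg s)).
{ intros s Hs.
  apply (is_derive_Re_curve (k * (x, y)) p1 (p2 (s * x, s * y)%R)
    (fun s => s * x) (fun s => s * y)).
  - now apply Hd, HD.
  - auto_derive; [easy | ring].
  - auto_derive; [easy | ring]. }
assert (DG : forall s, 0 <= s <= 1 -> is_derive (fun s => s * g s) s (g s + s * dg s)).
{ intros s Hs.
  evar_last; [apply (is_derive_mult (K:=R_AbsRing) (fun s => s) g s 1 (dg s));
    [apply (is_derive_id (K:=R_AbsRing)) | now apply Dg | intros; apply Rmult_comm] |].
  unfold plus, mult; simpl; unfold mult; simpl; ring. }
destruct (continuity_ab_maj (fun s => s * g s) 0 1) as [m [Hmax Hm]]; [lra| |].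
{ intros s Hs; apply derivable_continuous_pt, ex_derive_Reals_0; eexists; now apply DG. }
assert (Hg1 : Re (k * ((x, y) * p1 (x, y)))%C = 1 * g 1).
{ unfold g; rewrite !Rmult_1_l; f_equal; ring. }
rewrite Hg1; apply Rle_trans with (1 := Hmax 1 ltac:(lra)).
destruct (Req_dec m 0) as [->|Hm0]; [rewrite Rmult_0_l; exact HKc|].
assert (L : 0 <= g m + m * dg m).
{ apply (is_derive_ge_0_of_left_max (fun s => s * g s) 0 m); [lra | now apply DG |].
  intros s Hs; apply Hmax; lra. }
apply (proj1 (Rle_div_r (m * g m) K c Hc)).
(* The left side regroups [(c + a2) * m * g m + a2 * m ^ 2 * dg m], the real part of [k] times the
   bounded expression at [m * (x, y)]. *)
assert (E : c * (m * g m) + a2 * (m * (g m + m * dg m)) <= K).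
{ eapply Rle_trans; [|apply (Hb _ (HD m Hm))].
  set (F := (_ + _)%C).
  rewrite <- (Rmult_1_l (Cmod F)), <- Hk, <- Cmod_mult.
  eapply Rle_trans; [|apply re_le_Cmod].
  eapply Rle_trans; [|apply Rle_abs].
  right; unfold F, g, dg.
  destruct k, (p1 (m * x, m * y)%R), (p2 (m * x, m * y)%R); unfold Re; simpl; ring. }
assert (0 <= a2 * (m * (g m + m * dg m)))
  by (apply Rmult_le_pos; [lra|]; apply Rmult_le_pos; [lra|exact L]).
lra.
Qed.

(** * The mean value property on circles *)

(** This is [r e^(it) z], in coordinates so that [is_derive_Re_curve] applies in either variable. *)
Definition circle (z : C) (r t : R) : C :=
  (r * (fst z * cos t - snd z * sin t), r * (fst z * sin t + snd z * cos t)).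

Lemma Cmod_circle (z : C) (r t : R) : Cmod (circle z r t) = Rabs r * Cmod z.
Proof.
unfold circle; rewrite Cmod_scale; f_equal.
unfold Cmod; simpl; f_equal.
pose proof (sin2_cos2 t) as E; unfold Rsqr in E.
transitivity ((fst z * fst z + snd z * snd z) * (sin t * sin t + cos t * cos t)); [ring|].
rewrite E; ring.
Qed.

Lemma continuity_2d_pt_Re_comp (c : C) (f : C -> C) (g1 g2 : R -> R -> R) (x y : R) :
  continuous (T:=C_UniformSpace) (U:=C_UniformSpace) f (g1 x y, g2 x y) ->
  continuity_2d_pt g1 x y -> continuity_2d_pt g2 x y ->
  continuity_2d_pt (fun u v => Re (c * f (g1 u v, g2 u v))%C) x y.
Proof.
intros Hf H1 H2.
apply continuity_2d_pt_filterlim in H1, H2.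
assert (K : filterlim (fun q : R * R => f (g1 (fst q) (snd q), g2 (fst q) (snd q)))
  (locally (x, y)) (locally (f (g1 x y, g2 x y)))).
{ apply (continuous_comp_2 (fun q : R * R => g1 (fst q) (snd q))
    (fun q : R * R => g2 (fst q) (snd q)) (fun a b => f (a, b)) (x, y)).
  - exact H1.
  - exact H2.
  - eapply continuous_ext; [|exact Hf].
    intros [a b]; reflexivity. }
assert (K1 : continuity_2d_pt (fun u v => fst (f (g1 u v, g2 u v))) x y).
{ apply continuity_2d_pt_filterlim.
  eapply filterlim_comp; [exact K|].
  apply (continuous_fst (U:=R_UniformSpace) (V:=R_UniformSpace)). }
assert (K2 : continuity_2d_pt (fun u v => snd (f (g1 u v, g2 u v))) x y).
{ apply continuity_2d_pt_filterlim.
  eapply filterlim_comp; [exact K|].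
  apply (continuous_snd (U:=R_UniformSpace) (V:=R_UniformSpace)). }
unfold Re, Cmult; simpl.
apply continuity_2d_pt_minus; apply continuity_2d_pt_mult;
  auto using continuity_2d_pt_const.
Qed.

Lemma is_derive_circle_radius (c : C) (f : C -> C) (l z : C) (r t : R) :
  Cderiv f (circle z r t) l ->
  is_derive (fun s => Re (c * f (circle z s t))%C) r (Re (c * (circle z 1 t * l))%C).
Proof.
intros H; unfold circle; rewrite !Rmult_1_l.
apply (is_derive_Re_curve c f l (fun s => s * (fst z * cos t - snd z * sin t))
  (fun s => s * (fst z * sin t + snd z * cos t)));
  [exact H | auto_derive; [easy | ring] ..].
Qed.

Lemma is_derive_circle_angle (c : C) (f : C -> C) (l z : C) (r t : R) :
  Cderiv f (circle z r t) l ->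
  is_derive (fun s => Re (c * f (circle z r s))%C) t (Re (c * (Ci * (circle z r t * l)))%C).
Proof.
intros H.
evar_last.
- apply (is_derive_Re_curve c f l (fun t => r * (fst z * cos t - snd z * sin t))
    (fun t => r * (fst z * sin t + snd z * cos t)));
    [exact H | auto_derive; [easy | reflexivity] ..].
- unfold circle; destruct c, l; unfold Re; simpl; ring.
Qed.

Lemma inD_circle (z : C) (r t : R) : inD z -> 0 <= r <= 1 -> inD (circle z r t).
Proof.
unfold inD; intros Hz Hr; rewrite Cmod_circle, Rabs_pos_eq by lra.
pose proof (Cmod_ge_0 z); nra.
Qed.

(** Two-sided derivatives in the radius at 0 and 1 need radii outside [0, 1]. Within [1 - Cmod z] of
    [r] one has [|s| < 2 - Cmod z], and [(2 - m) * m < 1] for [m < 1]. *)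
Lemma locally_inD_circle (z : C) (r : R) : inD z -> 0 <= r <= 1 ->
  locally r (fun s => forall t, inD (circle z s t)).
Proof.
unfold inD; intros Hz Hr.
assert (Hd : 0 < 1 - Cmod z) by lra.
exists (mkposreal _ Hd); intros s Hs t.
change (Rabs (s - r) < 1 - Cmod z) in Hs.
rewrite Cmod_circle.
pose proof (Cmod_ge_0 z).
assert (Rabs s < 2 - Cmod z).
{ apply Rabs_lt_between in Hs; apply Rabs_lt_between; lra. }
nra.
Qed.

Lemma continuity_2d_pt_line (f : R -> R -> R) (x y : R) :
  continuity_2d_pt f x y -> continuous (f x) y.
Proof.
intros H; apply continuity_2d_pt_filterlim in H.
apply (continuous_comp_2 (fun _ => x) (fun t => t) f y);
  [apply continuous_const | apply continuous_id | exact H].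
Qed.

Lemma continuity_2d_pt_trig (a b x y : R) :
  continuity_2d_pt (fun _ t => a * cos t + b * sin t) x y.
Proof.
apply continuity_2d_pt_plus; apply continuity_2d_pt_mult; try apply continuity_2d_pt_const;
  apply (continuity_1d_2d_pt_comp _ (fun _ t => t)); try apply continuity_2d_pt_id2.
- apply continuity_cos.
- apply continuity_sin.
Qed.

Section CircleMean.

Variables f f1 : C -> C.
Hypothesis Hf : forall z, inD z -> Cderiv f z (f1 z).
Hypothesis Hf1 :
  forall z, inD z -> continuous (T:=C_UniformSpace) (U:=C_UniformSpace) f1 z.

Lemma continuity_2d_pt_circle (c z : C) (r t : R) : inD (circle z r t) ->
  continuity_2d_pt (fun u v => Re (c * f1 (circle z u v))%C) r t.
Proof.
intros H.
apply (continuity_2d_pt_Re_comp c f1 (fun r t => r * (fst z * cos t - snd z * sin t))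
  (fun r t => r * (fst z * sin t + snd z * cos t))).
- now apply Hf1.
- apply continuity_2d_pt_mult; [apply continuity_2d_pt_id1|].
  eapply continuity_2d_pt_ext; [|apply (continuity_2d_pt_trig (fst z) (- snd z))].
  intros; simpl; ring.
- apply continuity_2d_pt_mult; [apply continuity_2d_pt_id1|].
  eapply continuity_2d_pt_ext; [|apply (continuity_2d_pt_trig (snd z) (fst z))].
  intros; simpl; ring.
Qed.

(** Differentiation under the integral requires this joint continuity. Splitting [circle z 1 v] into
    real and imaginary parts reduces it to [f1] tested against [c] and [c * Ci]. *)
Lemma continuity_2d_pt_circle_radial (c z : C) (r t : R) : inD (circle z r t) ->
  continuity_2d_pt (fun u v => Re (c * (circle z 1 v * f1 (circle z u v)))%C) r t.
Proof.
intros H.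
apply (continuity_2d_pt_ext (fun u v =>
  (fst z * cos v + - snd z * sin v) * Re (c * f1 (circle z u v))%C +
  (snd z * cos v + fst z * sin v) * Re (c * Ci * f1 (circle z u v))%C)).
- intros u v; destruct c, (f1 (circle z u v)); unfold Re, circle; simpl; ring.
- apply continuity_2d_pt_plus; apply continuity_2d_pt_mult;
    auto using continuity_2d_pt_trig, continuity_2d_pt_circle.
Qed.

(** The radial derivative of [f] is [- Ci / r] times the angular one, so the integrand is the
    derivative in [t] of a function with equal values at [- PI] and [PI]. *)
Lemma RInt_circle_radial (c z : C) (r : R) : inD z -> 0 < r <= 1 ->
  RInt (fun t => Re (c * (circle z 1 t * f1 (circle z r t)))%C) (- PI) PI = 0.
Proof.
intros Hz Hr.
apply is_RInt_unique.
evar_last.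
- apply (is_RInt_derive (fun t => Re (- Ci * c / r * f (circle z r t))%C)).
  + intros t _.
    evar_last; [apply is_derive_circle_angle, Hf, inD_circle; [exact Hz | lra]|].
    cbv beta; apply (f_equal Re).
    replace (circle z r t) with (RtoC r * circle z 1 t)%C at 1
      by (unfold circle, Cmult, RtoC; simpl; f_equal; ring).
    assert (E : (Ci * Ci = - RtoC 1)%C) by (unfold Ci, Cmult, RtoC, Copp; simpl; f_equal; ring).
    assert (RtoC r <> RtoC 0) by (intros E'; injection E'; lra).
    transitivity (- (Ci * Ci) * (c * (circle z 1 t * f1 (circle z r t))))%C;
      [field; assumption | rewrite E; ring].
  + intros t _.
    apply (continuity_2d_pt_line (fun u v => Re (c * (circle z 1 v * f1 (circle z u v)))%C)).
    apply continuity_2d_pt_circle_radial, inD_circle; [exact Hz | lra].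
- unfold minus, plus, opp; simpl.
  unfold circle; rewrite cos_neg, sin_neg, sin_PI, Ropp_0; ring.
Qed.

Lemma continuous_Re_circle (c z : C) (r t : R) : inD (circle z r t) ->
  continuous (fun t => Re (c * f (circle z r t))%C) t.
Proof.
intros H; apply (ex_derive_continuous (K:=R_AbsRing) (V:=R_NormedModule)).
eexists; now apply is_derive_circle_angle, Hf.
Qed.

Lemma is_derive_RInt_circle (c z : C) (r : R) : inD z -> 0 <= r <= 1 ->
  is_derive (fun s => RInt (fun t => Re (c * f (circle z s t))%C) (- PI) PI) r
    (RInt (fun t => Re (c * (circle z 1 t * f1 (circle z r t)))%C) (- PI) PI).
Proof.
intros Hz Hr.
pose proof (locally_inD_circle z r Hz Hr) as L.
assert (E : forall s t, inD (circle z s t) ->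
  Derive (fun u => Re (c * f (circle z u t))%C) s =
  Re (c * (circle z 1 t * f1 (circle z s t)))%C)
  by (intros s t H; now apply is_derive_unique, is_derive_circle_radius, Hf).
evar_last.
- apply is_derive_RInt_param.
  + apply filter_imp with (2 := L); intros s Hs t _.
    eexists; apply is_derive_circle_radius, Hf, Hs.
  + intros t _.
    eapply continuity_2d_pt_ext_loc;
      [|apply (continuity_2d_pt_circle_radial c z); now apply inD_circle].
    destruct L as [d Hd].
    exists d; intros u v Hu _; symmetry; now apply E, Hd.
  + apply filter_imp with (2 := L); intros s Hs.
    apply (ex_RInt_continuous (V:=R_CompleteNormedModule)); intros t _.
    now apply continuous_Re_circle.
- apply RInt_ext; intros t _; now apply E, inD_circle.
Qed.

(** The integral has zero derivative in the radius, hence agrees at radii 1 and 0, where the circle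
    collapses to the centre. The mean value theorem gives a radius strictly above 0, as
    [RInt_circle_radial] demands. *)
Lemma circle_mean (c z : C) : inD z ->
  RInt (fun t => Re (c * f (circle z 1 t))%C) (- PI) PI = 2 * PI * Re (c * f (RtoC 0))%C.
Proof.
intros Hz.
destruct (MVT_cor2 (fun s => RInt (fun t => Re (c * f (circle z s t))%C) (- PI) PI)
  (fun r => RInt (fun t => Re (c * (circle z 1 t * f1 (circle z r t)))%C) (- PI) PI) 0 1)
  as [r [E Hr]]; [lra| |].
- intros r Hr; apply is_derive_Reals; now apply is_derive_RInt_circle.
- rewrite RInt_circle_radial in E by (trivial; lra).
  assert (E0 : RInt (fun t => Re (c * f (circle z 0 t))%C) (- PI) PI =
    2 * PI * Re (c * f (RtoC 0))%C).
  { rewrite (RInt_ext _ (fun _ => Re (c * f (RtoC 0))%C)).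
    - rewrite RInt_const; unfold scal; simpl; unfold mult; simpl; ring.
    - intros t _; unfold circle, RtoC; now rewrite !Rmult_0_l. }
  lra.
Qed.

(* On the circle through [z], [f] varies by at most [B |t|] over an arc of angle [t], and the
   mean of [|t|] over [-pi, pi] is [pi / 2]. *)
Lemma Cmod_sub_center_le (B : R) (z : C) :
  (forall z, inD z -> Cmod (z * f1 z) <= B) -> inD z ->
  Cmod (f z - f (RtoC 0)) <= PI / 2 * B.
Proof.
intros HB Hz.
pose proof PI_RGT_0 as HPI.
assert (HB0 : 0 <= B) by (eapply Rle_trans; [apply Cmod_ge_0 | apply (HB z Hz)]).
apply Cmod_le_of_Re; [nra|].
intros c Hc.
set (U := fun t => Re (c * f (circle z 1 t))%C).
assert (HU : forall t, U 0 - B * Rabs t <= U t).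
{ intros t.
  destruct (MVT_gen U 0 t (fun t => Re (c * (Ci * (circle z 1 t * f1 (circle z 1 t))))%C))
    as [s [_ E]].
  - intros s _; apply is_derive_circle_angle, Hf, inD_circle; [exact Hz | lra].
  - intros s _; apply continuity_pt_filterlim, continuous_Re_circle, inD_circle;
      [exact Hz | lra].
  - rewrite Rminus_0_r in E.
    assert (A : Rabs (U t - U 0) <= B * Rabs t).
    { rewrite E, Rabs_mult; apply Rmult_le_compat_r; [apply Rabs_pos|].
      eapply Rle_trans; [apply re_le_Cmod|].
      rewrite !Cmod_mult, Hc.
      rewrite Cmod_Ci.
      rewrite !Rmult_1_l, <- Cmod_mult.
      apply HB, inD_circle; [exact Hz | lra]. }
    apply Rabs_le_between in A; lra. }
assert (CU : forall a b, ex_RInt U a b).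
{ intros a b; apply (ex_RInt_continuous (V:=R_CompleteNormedModule)); intros t _.
  apply continuous_Re_circle, inD_circle; [exact Hz | lra]. }
assert (I : forall k a b, is_RInt (fun t => U 0 - k * t) a b
  (U 0 * (b - a) - k * (b ^ 2 - a ^ 2) / 2)).
{ intros k a b; evar_last.
  - apply (is_RInt_derive (fun t => U 0 * t - k * t ^ 2 / 2)).
    + intros t _; auto_derive; [easy | field].
    + intros t _; apply (ex_derive_continuous (K:=R_AbsRing) (V:=R_NormedModule)).
      auto_derive; easy.
  - unfold minus, plus, opp; simpl; field. }
assert (IU : forall k a b, RInt (fun t => U 0 - k * t) a b =
  U 0 * (b - a) - k * (b ^ 2 - a ^ 2) / 2 :> R)
  by (intros k a b; apply is_RInt_unique, I).
(* The two halves together give [2 * PI * U 0 - B * PI ^ 2] as a lower bound for the full integral,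
   which [circle_mean] evaluates; division by [2 * PI] then leaves [PI / 2 * B]. *)
assert (I1 : U 0 * PI - B * PI ^ 2 / 2 <= RInt U 0 PI).
{ apply Rle_trans with (RInt (fun t => U 0 - B * t) 0 PI); [right; rewrite IU; field|].
  apply RInt_le; [lra | eexists; apply I | apply CU |].
  intros t Ht; specialize (HU t); rewrite Rabs_pos_eq in HU; lra. }
assert (I2 : U 0 * PI - B * PI ^ 2 / 2 <= RInt U (- PI) 0).
{ apply Rle_trans with (RInt (fun t => U 0 - (- B) * t) (- PI) 0); [right; rewrite IU; field|].
  apply RInt_le; [lra | eexists; apply I | apply CU |].
  intros t Ht; specialize (HU t); rewrite Rabs_left in HU; lra. }
pose proof (RInt_Chasles U (- PI) 0 PI (CU _ _) (CU _ _)) as Ch.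
unfold plus in Ch; simpl in Ch; unfold U at 3 in Ch; rewrite circle_mean in Ch by exact Hz.
assert (Z : U 0 = Re (c * f z)%C).
{ assert (Z0 : circle z 1 0 = z)
    by (unfold circle; rewrite cos_0, sin_0; destruct z; simpl; f_equal; ring).
  unfold U; now rewrite Z0. }
replace (Re (c * (f z - f (RtoC 0)))%C) with (Re (c * f z)%C - Re (c * f (RtoC 0))%C)
  by (unfold Re; simpl; ring).
rewrite <- Z.
apply Rmult_le_reg_l with (2 * PI); [lra|].
nra.
Qed.

End CircleMean.

(** * The complex exponential and its local inverse *)

(** The upper bound combines [exp_sym_le_quadratic] with [exp (- a) >= 1 - a]; the lower one is
    [exp a >= 1 + a]. *)
Lemma exp_taylor1 (a : R) : Rabs a <= 1 -> Rabs (exp a - 1 - a) <= 2 * a ^ 2.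
Proof.
intros Ha; pose proof (exp_sym_le_quadratic a Ha).
pose proof (exp_ineq1_le a); pose proof (exp_ineq1_le (- a)).
apply Rabs_le; nra.
Qed.

Lemma sin_taylor1 (b : R) : Rabs b <= 1 -> Rabs (sin b - b) <= b ^ 2.
Proof.
intros Hb.
destruct (MVT_gen (fun t => sin t - t) 0 b (fun t => cos t - 1)) as [c [Hc E]].
- intros t _; auto_derive; [easy | ring].
- intros t _; apply derivable_continuous_pt, ex_derive_Reals_0; auto_derive; easy.
- rewrite sin_0, !Rminus_0_r in E; rewrite E, Rabs_mult, <- pow2_abs.
  pose proof (cos_ge_quadratic c); pose proof (COS_bound c).
  assert (Hcb : c ^ 2 <= b ^ 2).
  { unfold Rmin, Rmax in Hc; destruct (Rle_dec 0 b); nra. }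
  assert (Rabs (cos c - 1) <= b ^ 2) by (apply Rabs_le; nra).
  rewrite <- pow2_abs in H1.
  pose proof (Rabs_pos b); nra.
Qed.

Lemma Cmod_le_add (x y : R) : Cmod (x, y) <= Rabs x + Rabs y.
Proof.
replace (x, y) with (RtoC x + Ci * RtoC y)%C
  by (unfold Ci, RtoC, Cplus, Cmult; simpl; f_equal; ring).
eapply Rle_trans; [apply Cmod_triangle|].
rewrite Cmod_mult, !Cmod_R, Cmod_Ci; lra.
Qed.

(** Any constant would serve. The coordinates of the remainder, bounded separately, add up to at
    most [4.5 a^2 + 6.5 b^2]. *)
Lemma Cexp_taylor1 (h : C) : Cmod h <= 1 ->
  Cmod (Cexp h - RtoC 1 - h) <= 10 * Cmod h ^ 2.
Proof.
intros Hh; destruct h as [a b].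
pose proof (Rle_trans _ _ _ (Rmax_l _ _) (Rmax_Cmod (a, b))) as Ha.
pose proof (Rle_trans _ _ _ (Rmax_r _ _) (Rmax_Cmod (a, b))) as Hb.
pose proof (Cmod2_alt (a, b)) as E; unfold Re, Im in E.
set (m := Cmod (a, b)) in *.
simpl fst in *; simpl snd in *; rewrite E.
pose proof (exp_taylor1 a ltac:(lra)) as Ea.
pose proof (sin_taylor1 b ltac:(lra)) as Eb.
pose proof (cos_ge_quadratic b); pose proof (COS_bound b).
assert (Hb1 : Rabs b <= 1) by lra; assert (Ha1 : Rabs a <= 1) by lra.
assert (H3 : exp a <= 4).
{ apply Rabs_le_between in Ea; apply Rabs_le_between in Ha1; nra. }
pose proof (exp_pos a).
replace (Cexp (a, b) - RtoC 1 - (a, b))%C with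
  ((exp a - 1 - a) + exp a * (cos b - 1),
   exp a * (sin b - b) + ((exp a - 1 - a) * b + a * b))%R
  by (unfold Cexp, Cminus, Cplus, Copp, RtoC; simpl; f_equal; ring).
eapply Rle_trans; [apply Cmod_le_add|].
assert (P1 : Rabs ((exp a - 1 - a) + exp a * (cos b - 1)) <= 2 * a ^ 2 + 2 * b ^ 2).
{ eapply Rle_trans; [apply Rabs_triang|].
  rewrite Rabs_mult, (Rabs_pos_eq (exp a)) by lra.
  assert (Rabs (cos b - 1) <= b ^ 2 / 2) by (apply Rabs_le; lra).
  pose proof (Rabs_pos (cos b - 1)); nra. }
assert (P2 : Rabs (exp a * (sin b - b) + ((exp a - 1 - a) * b + a * b)) <=
  4 * b ^ 2 + (2 * a ^ 2 + (a ^ 2 + b ^ 2) / 2)).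
{ eapply Rle_trans; [apply Rabs_triang|].
  apply Rplus_le_compat.
  - rewrite Rabs_mult, (Rabs_pos_eq (exp a)) by lra.
    pose proof (Rabs_pos (sin b - b)); nra.
  - eapply Rle_trans; [apply Rabs_triang|].
    rewrite !Rabs_mult.
    pose proof (Rabs_pos (exp a - 1 - a)); pose proof (Rabs_pos b); pose proof (Rabs_pos a).
    apply Rplus_le_compat; [clear - Ea H2 Hb1; nra|].
    rewrite <- (pow2_abs a), <- (pow2_abs b).
    pose proof (pow2_ge_0 (Rabs a - Rabs b)); lra. }
nra.
Qed.

Lemma Cexp_plus (x y : C) : Cexp (x + y) = (Cexp x * Cexp y)%C.
Proof.
destruct x, y; unfold Cexp, Cmult, Cplus; simpl.
rewrite exp_plus, cos_plus, sin_plus; f_equal; ring.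
Qed.

(* Since [f y = f z * exp (h)] with [h = v y - v z], the increment [h] agrees with
   [(f y - f z) / f z] up to [O(|h|^2)], and [h] tends to 0 by continuity. *)
Lemma Cderiv_log (f v : C -> C) (z l : C) :
  Cderiv f z l -> f z <> RtoC 0 ->
  continuous (T:=C_UniformSpace) (U:=C_UniformSpace) v z ->
  locally (T:=C_UniformSpace) z (fun y => Cexp (v y) = f y) ->
  Cderiv v z (l / f z).
Proof.
intros Hf Hz Hv He.
apply Cderiv_iff; intros eps Heps.
set (A := Cmod (f z)).
assert (HA : 0 < A) by now apply Cmod_gt_0.
pose proof (Cmod_ge_0 l) as HL; set (L := Cmod l) in *.
set (e1 := eps * A / 2).
assert (He1 : 0 < e1) by (unfold e1; nra).
(* The linear error [e1] and the quadratic error [10 * A * m ^ 2] each get half of [eps * A]. The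
   bound 1/20 gives [10 * m ^ 2 <= m / 2], so that [S2] can absorb the quadratic term; the other
   bound makes [20 * eta * (e1 + L)] at most [eps * A / 2] in [S3]. *)
set (eta := Rmin (1 / 20) (eps * A / (40 * (e1 + L)))).
assert (Heta : 0 < eta).
{ apply Rmin_glb_lt; [lra|]; apply Rdiv_lt_0_compat; nra. }
assert (Heta1 : eta <= 1 / 20) by apply Rmin_l.
assert (Heta2 : eta * (40 * (e1 + L)) <= eps * A).
{ apply Rle_div_r; [nra | apply Rmin_r]. }
destruct (proj1 (Cderiv_iff f z l) Hf e1 He1) as [d1 [Hd1 H1]].
assert (Hv' : locally (T:=C_UniformSpace) z (fun y => Cmod (v y - v z) < eta)).
{ apply (Hv (fun w => Cmod (w - v z) < eta)).
  apply locally_C; exists (mkposreal eta Heta); intros w Hw; exact Hw. }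
destruct (proj1 (locally_C _ _) (filter_and _ _ He Hv')) as [d2 H2].
exists (Rmin d1 d2); split; [apply Rmin_glb_lt; [exact Hd1 | apply cond_pos]|].
intros y Hy.
specialize (H1 y (Rlt_le_trans _ _ _ Hy (Rmin_l _ _))).
destruct (H2 y (Rlt_le_trans _ _ _ Hy (Rmin_r _ _))) as [Ey Hh].
apply locally_singleton in He.
set (h := (v y - v z)%C) in *.
assert (Ef : f y = (f z * Cexp h)%C).
{ rewrite <- Ey, <- He, <- Cexp_plus; f_equal; unfold h; ring. }
pose proof (Cexp_taylor1 h ltac:(lra)) as T.
set (D := Cmod (y - z)) in *; set (m := Cmod h) in *.
pose proof (Cmod_ge_0 (y - z)) as HD; fold D in HD.
pose proof (Cmod_ge_0 h) as Hm; fold m in Hm.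
assert (S1 : Cmod (f y - f z) <= (e1 + L) * D).
{ replace (f y - f z)%C with ((f y - f z - (y - z) * l) + (y - z) * l)%C by ring.
  eapply Rle_trans; [apply Cmod_triangle|]; rewrite Cmod_mult; fold D L; lra. }
assert (S2 : A * m <= 2 * ((e1 + L) * D)).
{ assert (Q : A * m <= Cmod (f y - f z) + A * (10 * m ^ 2)).
  { replace (A * m) with (Cmod (f z * h)) by (rewrite Cmod_mult; reflexivity).
    replace (f z * h)%C with ((f y - f z) + - (f z * (Cexp h - RtoC 1 - h)))%C
      by (rewrite Ef; ring).
    eapply Rle_trans; [apply Cmod_triangle|].
    rewrite Cmod_opp, Cmod_mult; fold A.
    apply Rplus_le_compat_l, Rmult_le_compat_l; [lra | exact T]. }
  assert (10 * m ^ 2 <= m / 2) by nra.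
  nra. }
apply Rmult_le_reg_l with A; [exact HA|].
unfold A at 1; rewrite <- Cmod_mult.
replace (f z * (h - (y - z) * (l / f z)))%C with
  ((f y - f z - (y - z) * l) + - (f z * (Cexp h - RtoC 1 - h)))%C
  by (rewrite Ef; field; exact Hz).
eapply Rle_trans; [apply Cmod_triangle|].
rewrite Cmod_opp, Cmod_mult; fold A.
assert (S3 : A * (10 * m ^ 2) <= eps * A / 2 * D).
{ apply Rle_trans with (10 * eta * (A * m)).
  - assert (m * m <= eta * m) by (apply Rmult_le_compat_r; lra).
    nra.
  - apply Rle_trans with (10 * eta * (2 * ((e1 + L) * D))).
    + apply Rmult_le_compat_l; nra.
    + nra. }
assert (S4 : A * Cmod (Cexp h - RtoC 1 - h) <= A * (10 * m ^ 2))
  by (apply Rmult_le_compat_l; lra).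
unfold e1 in H1; nra.
Qed.

(* The principal logarithm; a junk value outside the right half plane. *)
Definition Clog (w : C) : C := (ln (fst w ^ 2 + snd w ^ 2) / 2, atan (snd w / fst w)).

(** For [x > 0] the modulus is [x * sqrt (1 + (y / x)^2)], and this square root cancels the
    denominators of [cos (atan (y / x))] and [sin (atan (y / x))]. *)
Lemma Cexp_Clog (w : C) : 0 < fst w -> Cexp (Clog w) = w.
Proof.
destruct w as [x y]; intros Hx; unfold Cexp, Clog; cbn [fst snd] in *.
assert (Hp : 0 < x ^ 2 + y ^ 2) by nra.
assert (S : forall t, exp (t / 2) ^ 2 = exp t)
  by (intros t; simpl; rewrite Rmult_1_r, <- exp_plus; f_equal; field).
assert (E : exp (ln (x ^ 2 + y ^ 2) / 2) = x * sqrt (1 + Rsqr (y / x))).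
{ rewrite <- (sqrt_pow2 (exp _)) by (left; apply exp_pos).
  rewrite <- (sqrt_pow2 x) at 2 by lra.
  rewrite <- sqrt_mult_alt by nra; f_equal.
  rewrite S, exp_ln by exact Hp; unfold Rsqr; field; lra. }
assert (0 < sqrt (1 + Rsqr (y / x))) by (apply sqrt_lt_R0; pose proof (Rle_0_sqr (y / x)); lra).
rewrite E, cos_atan, sin_atan; f_equal; field; lra.
Qed.

Lemma continuous_Clog (w : C) : 0 < fst w ->
  continuous (T:=C_UniformSpace) (U:=C_UniformSpace) Clog w.
Proof.
destruct w as [x y]; simpl; intros Hx.
apply (continuous_comp_2 (U:=C_UniformSpace) (V:=R_UniformSpace) (W:=R_UniformSpace)
  (X:=C_UniformSpace) (fun w => ln (fst w ^ 2 + snd w ^ 2) / 2)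
  (fun w => atan (snd w / fst w)) (fun a b => (a, b))).
- apply (continuity_2d_pt_filterlim (fun x y => ln (x ^ 2 + y ^ 2) / 2)).
  apply (continuity_1d_2d_pt_comp (fun t => ln t / 2) (fun x y => x ^ 2 + y ^ 2)).
  + apply derivable_continuous_pt, ex_derive_Reals_0; auto_derive; simpl; nra.
  + apply continuity_2d_pt_plus; apply (continuity_1d_2d_pt_comp (fun t => t ^ 2));
      try apply continuity_2d_pt_id1; try apply continuity_2d_pt_id2;
      apply derivable_continuous_pt, ex_derive_Reals_0; auto_derive; easy.
- apply (continuity_2d_pt_filterlim (fun x y => atan (y / x))).
  apply (continuity_1d_2d_pt_comp atan (fun x y => y / x)).
  + apply derivable_continuous_pt, derivable_pt_atan.
  + apply continuity_2d_pt_mult; [apply continuity_2d_pt_id2|].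
    apply continuity_2d_pt_inv; [apply continuity_2d_pt_id1 | simpl; lra].
- eapply continuous_ext; [|apply continuous_id]; intros [a b]; reflexivity.
Qed.

Lemma locally_fst_pos (f : C -> C) (z : C) :
  continuous (T:=C_UniformSpace) (U:=C_UniformSpace) f z -> 0 < fst (f z) ->
  locally (T:=C_UniformSpace) z (fun y => 0 < fst (f y)).
Proof.
intros Hf Hz.
apply (Hf (fun w => 0 < fst w)).
exists (mkposreal _ Hz); intros w [Hw _].
change (Rabs (fst w - fst (f z)) < fst (f z)) in Hw.
apply Rabs_lt_between in Hw; lra.
Qed.

Lemma Cderiv_Clog_comp (f : C -> C) (z l : C) :
  Cderiv f z l -> 0 < fst (f z) -> Cderiv (fun y => Clog (f y)) z (l / f z).
Proof.
intros Hf Hz.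
pose proof (Cderiv_continuous f z l Hf) as Cf.
apply Cderiv_log; [exact Hf | | |].
- intros E; rewrite E in Hz; simpl in Hz; lra.
- apply (continuous_comp (U:=C_UniformSpace) (V:=C_UniformSpace) (W:=C_UniformSpace));
    [exact Cf | now apply continuous_Clog].
- eapply filter_imp; [|apply (locally_fst_pos f z Cf Hz)].
  intros y; apply Cexp_Clog.
Qed.

Lemma Cderiv_id (z : C) : Cderiv (fun y => y) z (RtoC 1).
Proof.
apply Cderiv_iff; intros eps Heps; exists 1; split; [lra|].
intros y _; replace (y - z - (y - z) * RtoC 1)%C with (RtoC 0) by ring.
rewrite Cmod_0; pose proof (Cmod_ge_0 (y - z)); nra.
Qed.

Lemma Clog_1 : Clog (RtoC 1) = RtoC 0.
Proof.
unfold Clog, RtoC; simpl; f_equal.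
- replace (1 * (1 * 1) + 0 * (0 * 1)) with 1 by ring; rewrite ln_1; field.
- unfold Rdiv; rewrite Rmult_0_l; apply atan_0.
Qed.

(** Along the segment [1 + s u] the logarithm has speed [r / |1 + s u| <= r / (1 - s r)], the
    derivative of [- ln (1 - s r)]. Hence [f] below has nonpositive derivative and starts at 0. *)
Lemma Cmod_Clog_le (u : C) : Cmod u < 1 -> Cmod (Clog (RtoC 1 + u)) <= - ln (1 - Cmod u).
Proof.
intros Hu; pose proof (Cmod_ge_0 u) as Hu0; set (r := Cmod u) in *.
apply Cmod_le_of_Re.
{ rewrite <- Ropp_0, <- ln_1; apply Ropp_le_contravar, ln_le; lra. }
intros c Hc; destruct u as [x y].
pose proof (re_le_Cmod (x, y)) as Hx; unfold Re in Hx; fold r in Hx; simpl in Hx.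
set (df := fun s => Re (c * ((x, y) * (RtoC 1 / (1 + s * x, s * y)%R)))%C).
set (f := fun s => Re (c * Clog (1 + s * x, s * y)%R)%C + ln (1 - s * r)).
assert (P : forall s, 0 <= s <= 1 -> 0 < 1 + s * x).
{ intros s Hs; apply Rabs_le_between in Hx; nra. }
assert (Df : forall s, 0 <= s <= 1 -> is_derive f s (df s - r / (1 - s * r))).
{ intros s Hs; specialize (P s Hs).
  apply (is_derive_plus (K:=R_AbsRing) (V:=R_NormedModule)).
  - apply (is_derive_Re_curve c Clog _ (fun s => 1 + s * x) (fun s => s * y)).
    + apply (Cderiv_Clog_comp (fun y => y)); [apply Cderiv_id | exact P].
    + auto_derive; [easy | ring].
    + auto_derive; [easy | ring].
  - auto_derive; [nra | field; nra]. }
destruct (MVT_cor2 f (fun s => df s - r / (1 - s * r)) 0 1) as [s [E Hs]]; [lra| |].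
{ intros s Hs; now apply is_derive_Reals, Df. }
assert (F0 : f 0 = 0).
{ unfold f; rewrite !Rmult_0_l, Rplus_0_r, Rminus_0_r, ln_1.
  change (1, 0)%R with (RtoC 1); rewrite Clog_1, Cmult_0_r; simpl; ring. }
assert (F1 : f 1 = Re (c * Clog (RtoC 1 + (x, y)))%C + ln (1 - r)).
{ unfold f; rewrite !Rmult_1_l; do 4 f_equal.
  unfold RtoC, Cplus; simpl; f_equal; ring. }
assert (B : df s <= r / (1 - s * r)).
{ eapply Rle_trans; [apply Rle_abs|]; eapply Rle_trans; [apply re_le_Cmod|].
  assert (Hd : 1 - s * r <= Cmod (1 + s * x, s * y)%R).
  { pose proof (Cmod_triangle (1 + s * x, s * y)%R (- (s * x), - (s * y))%R) as T.
    replace (Cplus _ _) with (RtoC 1) in T by (unfold RtoC, Cplus; simpl; f_equal; ring).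
    replace (- (s * x), - (s * y))%R with (- (s * x, s * y)%R)%C in T
      by (unfold Copp; reflexivity).
    rewrite Cmod_1, Cmod_opp, Cmod_scale, Rabs_pos_eq in T by lra.
    fold r in T; lra. }
  assert (0 < 1 - s * r) by nra.
  rewrite !Cmod_mult, Hc, Cmod_div, Cmod_1 by (apply Cmod_gt_0; lra).
  fold r; rewrite Rmult_1_l.
  apply Rmult_le_compat_l; [lra|].
  unfold Rdiv; rewrite Rmult_1_l; apply Rinv_le_contravar; lra. }
lra.
Qed.
Theorem theorem4p5 (r0 a1 a2 : R) (p p1 p2 : C -> C) :
  (0 < r0)%R ->
  (r0 ^ 2 + 2 * (cos 1 / sin 1) * r0 - 1 = 0)%R ->
  (0 < a1)%R -> (0 < a2)%R ->
  (a1 - a2 >= exp 1 * r0)%R ->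
  (forall z, inD z -> Cderiv p z (p1 z)) ->
  (forall z, inD z -> Cderiv p1 z (p2 z)) ->
  p (RtoC 0) = RtoC 1 ->
  subordinate
    (fun z => (RtoC 1 + RtoC a1 * z * p1 z + RtoC a2 * (z * z) * p2 z)%C)
    (fun z => (RtoC 2 / (RtoC 1 + Cexp (- z)))%C) ->
  subordinate p Cexp.
Proof.
intros Hr0 Hroot Ha1 Ha2 Ha Hp Hp1 Hp0 [w [_ [HwD [_ Hw]]]].
pose proof (exp_pos 1) as He.
set (c := a1 - a2) in *.
assert (Hc : 0 < c) by nra.
assert (Hq : forall z, inD z -> Cmod (z * p1 z) <= 0.578 / c).
{ apply (radial_bound c a2 0.578 p1 p2); [exact Hc | exact Ha2 | lra | exact Hp1 |].
  intros z Hz; replace (c + a2) with a1 by (unfold c; ring).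
  replace (RtoC a1 * z * p1 z + RtoC a2 * (z * z) * p2 z)%C with
    (RtoC 1 + RtoC a1 * z * p1 z + RtoC a2 * (z * z) * p2 z - RtoC 1)%C by ring.
  rewrite Hw by exact Hz; now apply sigmoid_bound, HwD. }
(* The threshold is where [- ln (1 - Cmod u)] reaches 1, so that [Clog (p z)] stays in the disk. *)
assert (Hu : forall z, inD z -> Cmod (p z - RtoC 1) < 1 - exp (- (1))).
{ intros z Hz; rewrite <- Hp0.
  eapply Rle_lt_trans.
  - apply (Cmod_sub_center_le p p1 Hp) with (B := 0.578 / c); [|exact Hq | exact Hz].
    intros y Hy; apply (Cderiv_continuous p1 y (p2 y)), Hp1, Hy.
  - rewrite exp_Ropp.
    apply Rmult_lt_reg_r with c; [exact Hc|].
    replace (PI / 2 * (0.578 / c) * c) with (PI / 2 * 0.578) by (field; lra).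
    apply Rlt_le_trans with (1 := constant_estimate r0 Hr0 Hroot).
    (* This form exposes [exp 1 * r0], which the hypothesis on [a1 - a2] bounds by [c]. *)
    replace ((exp 1 - 1) * r0) with ((1 - / exp 1) * (exp 1 * r0)) by (field; lra).
    apply Rmult_le_compat_l; [|lra].
    pose proof (exp_ineq1_le 1).
    assert (1 * / exp 1 < 1) by (apply Rlt_div_l; lra).
    lra. }
assert (He1 : 0 < exp (- (1))) by apply exp_pos.
assert (Hpos : forall z, inD z -> 0 < fst (p z)).
{ intros z Hz; specialize (Hu z Hz).
  pose proof (re_le_Cmod (p z - RtoC 1)) as H.
  apply Rabs_le_between in H; unfold Re in H; simpl in H; lra. }
exists (fun z => Clog (p z)); split; [|split; [|split]].
- intros z Hz; exists (p1 z / p z)%C; apply Cderiv_Clog_comp; auto.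
- intros z Hz; specialize (Hu z Hz); unfold inD.
  replace (p z) with (RtoC 1 + (p z - RtoC 1))%C by ring.
  eapply Rle_lt_trans; [apply Cmod_Clog_le; lra|].
  apply Ropp_lt_cancel; rewrite Ropp_involutive.
  rewrite <- (ln_exp (- (1))) at 1; apply ln_increasing; [exact He1 | lra].
- rewrite Hp0; exact Clog_1.
- intros z Hz; symmetry; apply Cexp_Clog; auto.
Qed.
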